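(* Let $n, k \geq 0$ and $r \geq 2$ be integers. If $\mathcal{F}$ is a locally $k$-wide family of subsets of an $n$-element set $X$, then the number of members of $\mathcal{F}$ with exactly $r$ elements is at most $\frac{nk}{r}$.
   Context: A family $\mathcal{F}$ of subsets of a finite set $X$ is locally $k$-wide iff for every $x \in X$ every antichain (with respect to inclusion) of $\{U \in \mathcal{F} \mid x \in U\}$ has at most $k$ members. *)

(* Defs.v *)
From mathcomp Require Import all_boot all_order all_algebra.

Set Implicit Arguments.
Unset Strict Implicit.
Unset Printing Implicit Defensive.

Definition antichain (X : finType) (A : {set {set X}}) : Prop :=
  forall U V : {set X}, U \in A -> V \in A -> U \subset V -> U = V.

Definition locally_wide (X : finType) (k : nat) (F : {set {set X}}) : Prop :=
  forall (x : X) (A : {set {set X}}),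
    A \subset [set U in F | x \in U] -> antichain A -> #|A| <= k.

(* Main.v *)
Require Import Defs.
From mathcomp Require Import all_boot all_order all_algebra.

Import GRing.Theory Num.Theory.

Local Open Scope ring_scope.

(** Double counting of the pairs [(x, U)] with [x \in U], where [U] runs over the [r]-element
    members of [F]. Each such [U] lies in exactly [r] pairs. Each [x] lies in at most [k]: sets of
    equal size are never properly nested ([antichain_uniform]), so those through [x] form an
    antichain. Hence [r] times the number of such sets is at most [n * k]. *)

Lemma antichain_uniform (X : finType) (r : nat) (A : {set {set X}}) :
  (forall U : {set X}, U \in A -> #|U| = r) -> antichain A.
Proof.
move=> cardA U V UA VA sUV; apply/eqP.
by rewrite eqEcard sUV (cardA U UA) (cardA V VA) leqnn.
Qed.

Lemma sum_card_incidence (X : finType) (A : {set {set X}}) :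
  (\sum_(U in A) #|U| = \sum_(x : X) #|[set U in A | x \in U]|)%N.
Proof.
under eq_bigr do rewrite -sum1_card.
rewrite (exchange_big_dep xpredT) //=.
by apply: eq_bigr => x _; rewrite -sum1_card; apply: eq_bigl => U; rewrite inE.
Qed.

Theorem theorem3p3p5 (n k r : nat) (X : finType) (F : {set {set X}})
  (hr : (2 <= r)%N) (hX : #|X| = n) (hF : locally_wide k F) :
  #|[set U in F | #|U| == r]|%:R <= (n * k)%:R / r%:R :> rat.
Proof.
rewrite ler_pdivlMr ?ltr0n ?(ltnW hr) // -natrM ler_nat.
set Fr := [set U in F | _].
have cardFr (U : {set X}) : U \in Fr -> #|U| = r.
  by rewrite inE => /andP[_ /eqP].
(* The factor [r] is read back as [#|U|], so that the product counts incidences, which are then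
   regrouped by point. *)
rewrite -sum_nat_const -(eq_bigr _ cardFr) sum_card_incidence.
rewrite -hX -sum_nat_const; apply: leq_sum => x _; apply: (hF x).
  by apply/subsetP => U; rewrite !inE => /andP[/andP[-> _] ->].
by apply: (@antichain_uniform _ r) => U; rewrite inE => /andP[/cardFr].
Qed.
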